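(* Let $(a_n)_{n\ge 0}$ be the binary van der Corput sequence. For every integer $m \ge 1$ and $N = 4^m$, the $N$-th sequence graph of $(a_n)$ can be embedded into the Chamanara surface (drawn on it with no edge crossings).
   Context: The binary van der Corput sequence: if $n = \sum_{k=0}^{L-1} d_k(n) 2^k$ with $d_k(n)\in\{0,1\}$ is the binary expansion of $n$, then $a_n = \sum_{k=0}^{L-1} d_k(n)/2^{k+1}$ (reverse the binary digits of $n$ and place them after the binary point); its terms are pairwise distinct. For a sequence $a_0,a_1,\dots$ of pairwise distinct reals and $N\ge1$, let $\pi$ be the permutation of $\{0,\dots,N-1\}$ with $a_{\pi(0)}<\dots<a_{\pi(N-1)}$. The $N$-th sequence graph is the 4-regular graph on $\{0,\dots,N-1\}$ whose edges are those of two Hamiltonian cycles: $C_1$ with edges $(0,1),(1,2),\dots,(N-2,N-1),(N-1,0)$, and $C_\pi$ with edges $(\pi(0),\pi(1)),\dots,(\pi(N-2),\pi(N-1)),(\pi(N-1),\pi(0))$. The Chamanara surface is obtained from the unit square $[0,1]^2$ by gluing segments of its boundary by translations as follows. For each $k\ge1$, the top-side segment $h_k^{\mathrm{top}} = [\sum_{j=1}^{k-1}2^{-j}, \sum_{j=1}^{k}2^{-j}]\times\{1\}$ is identified by translation with the bottom-side segment $[2^{-k}, 2^{-k+1}]\times\{0\}$ (so the left half of the top is glued to the right half of the bottom, then the halves of the remaining parts are glued similarly, ad infinitum); and for each $k\ge1$ the right-side segment $\{1\}\times[\sum_{j=1}^{k-1}2^{-j}, \sum_{j=1}^{k}2^{-j}]$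 is identified by translation with the left-side segment $\{0\}\times[2^{-k},2^{-k+1}]$ (so the top half of the left side is glued to the bottom half of the right side, and so on). The resulting space (a non-compact translation surface of infinite genus) is the Chamanara surface. *)

(* Defs.v *)
From HB Require Import structures.
From Stdlib Require Import Relation_Operators Operators_Properties.
From mathcomp Require Import all_boot all_order all_algebra generic_quotient.
From mathcomp Require Import all_classical all_reals all_analysis.

Set Implicit Arguments.
Unset Strict Implicit.
Unset Printing Implicit Defensive.

Import Order.TTheory GRing.Theory Num.Theory.
Import numFieldNormedType.Exports.

Local Open Scope classical_set_scope.
Local Open Scope ring_scope.
Local Open Scope quotient_scope.

(** * Sequence graphs *)

(* Loops and parallel edges are allowed: the two Hamiltonian cycles of a
   sequence graph may share edges, and 4-regularity counts these twice. *)
Record multigraph := Multigraph {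
  vertex : finType;
  edge : finType;
  src : edge -> vertex;
  tgt : edge -> vertex }.

(* The sum may stop at k < n because n < 2 ^ n: all further digits vanish. *)
Definition vdcorput (R : realType) (n : nat) : R :=
  \sum_(k < n) ((n %/ 2 ^ k) %% 2)%:R / 2 ^+ k.+1.

Definition sort_perm (R : realType) (a : nat -> R) (N : nat) (i : 'I_N) : 'I_N :=
  tnth (sort_tuple (fun p q : 'I_N => a p <= a q) (ord_tuple N)) i.

(* The edges (false, i) form C_1, the edges (true, i) form C_pi; [ordS] is the
   successor modulo N. *)
Definition sequence_graph (R : realType) (a : nat -> R) (N : nat) : multigraph :=
  @Multigraph 'I_N (bool * 'I_N)%type
    (fun e => if e.1 then sort_perm a e.2 else e.2)
    (fun e => if e.1 then sort_perm a (ordS e.2) else ordS e.2).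

Lemma sort_perm_inj (R : realType) (a : nat -> R) (N : nat) :
  injective (@sort_perm R a N).
Proof.
move=> i j; apply: (tuple_uniqP _ _).
by rewrite sort_uniq val_ord_tuple enum_uniq.
Qed.

Lemma sort_perm_lt (R : realType) (a : nat -> R) (N : nat) :
  injective a ->
  forall i j : 'I_N, (i < j)%N -> a (sort_perm a i) < a (sort_perm a j).
Proof.
move=> a_inj i j ltij; rewrite lt_neqAle; apply/andP; split.
  apply/eqP => /a_inj /val_inj /sort_perm_inj eij.
  by rewrite eij ltnn in ltij.
rewrite /sort_perm !(tnth_nth i).
set s := tval _; have ss : size s = N by rewrite size_tuple.
have st : sorted (fun p q : 'I_N => a p <= a q) s.
  by apply: sort_sorted => p q; exact: le_total.
have tr : transitive (fun p q : 'I_N => a p <= a q).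
  by move=> y x z; exact: le_trans.
by apply: (sorted_ltn_nth tr i st) => //; rewrite inE ss ltn_ord.
Qed.

Lemma vdcorputE (R : realType) (n L : nat) : (n < 2 ^ L)%N ->
  vdcorput R n = \sum_(k < L) ((n %/ 2 ^ k) %% 2)%:R / 2 ^+ k.+1.
Proof.
pose F k : R := ((n %/ 2 ^ k) %% 2)%:R / 2 ^+ k.+1.
have cut m p : (n < 2 ^ m)%N -> (m <= p)%N ->
    \sum_(k < p) F k = \sum_(k < m) F k.
  move=> nm mp; rewrite -!(big_mkord xpredT) (big_cat_nat (n := m)) //=.
  rewrite [X in _ + X]big1_seq ?addr0 // => k /=.
  rewrite mem_index_iota => /andP[mk _].
  by rewrite /F divn_small ?mod0n ?mul0r // (leq_trans nm) // leq_exp2l.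
move=> nL; have nn : (n < 2 ^ n)%N by apply: ltn_expl.
rewrite /vdcorput -/(F _); case: (leqP n L) => h.
  by rewrite (cut n L).
by rewrite (cut L n) // ltnW.
Qed.

Lemma vdcorput_half (R : realType) (n : nat) :
  vdcorput R n = ((n %% 2)%:R + vdcorput R (n %/ 2)) / 2.
Proof.
have nL : (n < 2 ^ n.+1)%N by rewrite ltnW // ltn_expl.
have nL2 : (n %/ 2 < 2 ^ n)%N.
  by rewrite ltn_divLR // (leq_trans nL) // expnSr.
rewrite (vdcorputE R nL) (vdcorputE R nL2) big_ord_recl /= expn0 divn1 expr1.
rewrite mulrDl mulr_suml; congr (_ + _); apply: eq_bigr => k _.
by rewrite /bump /= add1n -divnMA -expnS [2 ^+ k.+2]exprSr invfM mulrA.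
Qed.

Lemma vdcorput_bound (R : realType) (n : nat) : 0 <= vdcorput R n < 1.
Proof.
elim/ltn_ind: n => n IH; case: (posnP n) => [->|n0].
  by rewrite /vdcorput big_ord0 lexx ltr01.
have /IH/andP[h0 h1] : (n %/ 2 < n)%N by rewrite ltn_Pdiv.
rewrite vdcorput_half; apply/andP; split.
  by rewrite divr_ge0 // addr_ge0.
rewrite ltr_pdivrMr // mul1r [ltRHS](_ : 2 = 1 + 1) // ler_ltD //.
by rewrite lern1 -ltnS ltn_mod.
Qed.

Lemma vdcorput_inj (R : realType) : injective (@vdcorput R).
Proof.
move=> n; elim/ltn_ind: n => n IH p.
have aux q : (q %% 2 = 0 \/ q %% 2 = 1)%N.
  by have := ltn_mod q 2; case: (q %% 2)%N => [|[|]] //; [left|right].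
have key : vdcorput R n = vdcorput R p ->
    (n %% 2 = p %% 2)%N /\ vdcorput R (n %/ 2) = vdcorput R (p %/ 2).
  rewrite vdcorput_half (vdcorput_half R p) => /(divIf _) /=.
  move=> /(_ (lt0r_neq0 (ltr0n _ 2))).
  have /andP[n0 n1] := vdcorput_bound R (n %/ 2).
  have /andP[p0 p1] := vdcorput_bound R (p %/ 2).
  case: (aux n) => ->; case: (aux p) => -> e.
  - by split=> //; move: e => /addrI.
  - by move: e n1; rewrite add0r => ->; rewrite ltNge lerDl p0.
  - by move: e p1; rewrite add0r => <-; rewrite ltNge lerDl n0.
  - by split=> //; move: e => /addrI.
move=> /key [emod ediv].
case: (posnP n) => [n0|n0]; last first.
  have /IH /(_ _ ediv) e : (n %/ 2 < n)%N by rewrite ltn_Pdiv.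
  by rewrite (divn_eq n 2) (divn_eq p 2) e emod.
have v0 : vdcorput R 0 = 0 by rewrite /vdcorput big_ord0.
move: emod ediv; rewrite n0 mod0n div0n v0.
move=> pm pv; case: (posnP p) => [//|p0].
have pd : (0 < p %/ 2)%N.
  rewrite divn_gt0 //; case: p p0 pm {pv key} => [|[|]] //.
suff pos q : (0 < q)%N -> 0 < vdcorput R q.
  by have := pos _ pd; rewrite -pv ltxx.
elim/ltn_ind: q => q IHq q0; rewrite vdcorput_half divr_gt0 //.
case: (posnP (q %/ 2)) => [qd|qd].
  have -> : (q %% 2 = 1)%N.
    by case: (aux q) => // qm; move: q0; rewrite (divn_eq q 2) qd qm.
  by rewrite ltr_pwDl //; case/andP: (vdcorput_bound R (q %/ 2)).
by rewrite ltr_wpDl // IHq // ltn_Pdiv.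
Qed.

(** * Drawing a graph on a topological space without crossings *)

(* [f] places the vertices and [g e] is the arc representing the edge [e]. On a
   Hausdorff space this says that the realization of G as a 1-dimensional cell
   complex is embedded. *)
Definition drawing (R : realType) (G : multigraph) (S : topologicalType)
    (f : vertex G -> S) (g : edge G -> R -> S) : Prop :=
  [/\ injective f,
      forall e, {within `[0, 1]%classic, continuous (g e)},
      forall e, g e 0 = f (src e) /\ g e 1 = f (tgt e),
      forall e v s, 0 < s < 1 -> g e s <> f v
    & forall e e' s t, 0 < s < 1 -> 0 < t < 1 ->
        g e s = g e' t -> e = e' /\ s = t].

Definition embeddable (R : realType) (G : multigraph) (S : topologicalType) :
    Prop :=
  exists (f : vertex G -> S) (g : edge G -> R -> S), drawing f g.

(** * The Chamanara surface *)

Definition dyadic_sum (R : realType) (k : nat) : R :=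
  \sum_(1 <= j < k.+1) 2 ^- j.

Definition unit_square (R : realType) : set (R * R) :=
  [set p | 0 <= p.1 <= 1 /\ 0 <= p.2 <= 1].
Arguments unit_square R : clear implicits.

(* The k-th top (resp. right) segment starts at [dyadic_sum k.-1], the k-th
   bottom (resp. left) segment at 2^-k, and all have length 2^-k. *)
Definition glue (R : realType) (p q : R * R) : Prop :=
  exists (k : nat) (t : R), [/\ (1 <= k)%N, 0 <= t <= 2 ^- k &
    (p = (dyadic_sum R k.-1 + t, 1) /\ q = (2 ^- k + t, 0)) \/
    (p = (1, dyadic_sum R k.-1 + t) /\ q = (0, 2 ^- k + t))].

(* The endpoints of the glued segments and the two corners at which the
   segments accumulate. These points are not part of the surface: near them the
   glued square is not locally Euclidean (and not even Hausdorff), and with them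
   it would be compact. *)
Definition singular (R : realType) : set (R * R) :=
  [set p | p = (0, 0) \/ p = (1, 1) \/
    exists k : nat,
      p = (dyadic_sum R k, 1) \/ p = (1, dyadic_sum R k) \/
      p = (2 ^- k, 0) \/ p = (0, 2 ^- k)].
Arguments singular R : clear implicits.

Definition punctured_square (R : realType) : set (R * R) :=
  unit_square R `\` singular R.
Arguments punctured_square R : clear implicits.

Definition glue_equiv (R : realType) : rel (punctured_square R) :=
  fun p q => `[< clos_refl_sym_trans _
    (fun p q : punctured_square R => glue (val p) (val q)) p q >].

Lemma glue_equiv_is_equiv (R : realType) : equiv_class_of (@glue_equiv R).
Proof.
split=> [p|p q|q p r].
- by apply/asboolP; apply: rst_refl.
- by apply/asboolP/asboolP => h; apply: rst_sym.
- by move=> /asboolP pq /asboolP qr; apply/asboolP; apply: rst_trans pq qr.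
Qed.

Canonical glue_equivRel (R : realType) :=
  EquivRelPack (@glue_equiv_is_equiv R).

Definition chamanara (R : realType) : topologicalType :=
  quotient_topology {eq_quot (glue_equivRel R)}.

(* Main.v *)
Require Import Defs.
From Stdlib Require Import Relation_Operators.
From mathcomp Require Import all_boot all_order all_algebra generic_quotient.
From mathcomp Require Import all_classical all_reals all_analysis.
From mathcomp Require Import ring lra zify.

(* Let M = 2^m and N = M^2, and let rev be the reversal of m binary digits. Put
   the vertex n = r + M q, with r < M, in column rev q and row r of an M x M
   grid in the square. The edge from n to n + 1 goes up by one row, and from the
   last row it leaves through the top side, whose gluing to the bottom side is
   the von Neumann-Kakutani odometer and sends column rev q to column
   rev (q + 1). Sorting the van der Corput sequence reverses 2 m digits, which
   exchanges rows and columns, so the edges of C_pi are the reflections of those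
   of C_1 in the diagonal, and the gluing has the same symmetry. Only the edges
   of the two cycles from N - 1 to 0 need care: they come back to the first cell
   off the grid lines and join its vertex inside this cell. *)

Set Implicit Arguments.
Unset Strict Implicit.
Unset Printing Implicit Defensive.

Import Order.TTheory GRing.Theory Num.Theory.
Import numFieldNormedType.Exports.

Local Open Scope classical_set_scope.
Local Open Scope ring_scope.
Local Open Scope quotient_scope.

(** * The surface as a quotient of the half-open square *)

Section chamanara_chart.
Variable R : realType.
Implicit Types p q r : R * R.

Lemma dyadic_sumE k : dyadic_sum R k = 1 - 2 ^- k.
Proof.
elim: k => [|k IHk]; first by rewrite /dyadic_sum big_geq // expr0 invr1 subrr.
rewrite /dyadic_sum big_nat_recr //= -/(dyadic_sum R k) IHk exprS invfM.
lra.
Qed.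

Lemma center_punctured : (2^-1, 2^-1) \in punctured_square R.
Proof.
apply/mem_set; split; first by split=> /=; lra.
case=> [[]|[[]|[k [|[|[|]]] []]]]; lra.
Qed.

(* Junk value outside the punctured square: the class of the center. *)
Definition chart p : chamanara R :=
  \pi_(chamanara R) (insubd (Sub (2^-1, 2^-1) center_punctured : punctured_square R) p).

(** An open set of the quotient pulls back to the trace of an open set [B] of the plane, so on [A]
    its preimage is that of [B] under [c]. *)
Lemma chart_continuous (A : set R) (c : R -> R * R) : continuous c ->
  (forall s, A s -> punctured_square R (c s)) ->
  {within A, continuous (chart \o c)}.
Proof.
move=> c_cont cP; apply/continuousP => U oU.
have := (continuousP _).1 (@pi_continuous _ {eq_quot (glue_equivRel R)}) U oU.
case=> B oB BU; apply/open_subspaceP; exists (c @^-1` B).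
  exact: (continuousP _).1 c_cont B oB.
have BE (z : punctured_square R) : B (val z) = U (\pi_(chamanara R) z).
  by rewrite -[LHS]/((set_val @^-1` B) z) BU.
apply/seteqP; split=> s [] h As; split=> //; move: h; rewrite /preimage /= /chart -BE.
  by rewrite insubdK //; apply/mem_set/cP.
by rewrite insubdK //; apply/mem_set/cP.
Qed.

Lemma chart_glue p q : punctured_square R p -> punctured_square R q ->
  Defs.glue p q -> chart p = chart q.
Proof.
move=> Pp Pq pq; apply/eqmodP/asboolP/rst_step.
by rewrite /= !insubdK //; apply/mem_set.
Qed.

Definition half_open_square : set (R * R) :=
  [set p | 0 <= p.1 < 1 /\ 0 <= p.2 < 1].

Lemma glue_half_open_squareN p q : Defs.glue p q -> ~ half_open_square p.
Proof.
by case=> k [t [_ _ []]] [-> _] [/= h1 h2]; lra.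
Qed.

Lemma half_pow_gt0 k : 0 < 2 ^- k :> R.
Proof. by rewrite invr_gt0 exprn_gt0. Qed.

Lemma half_pow_le1 k : 2 ^- k <= 1 :> R.
Proof. by rewrite invf_le1 ?exprn_gt0 // exprn_ege1 // ler1n. Qed.

Lemma half_powS k : 2 ^- k = 2 * 2 ^- k.+1 :> R.
Proof. by rewrite exprS invfM mulrA divff ?mul1r // pnatr_eq0. Qed.

(** A target coordinate can reach 1 only at the end of the first segment, at the corner [(1, 0)] or
    [(0, 1)], which is singular. *)
Lemma glue_half_open_square p q :
  punctured_square R q -> Defs.glue p q -> half_open_square q.
Proof.
move=> [_ nq] [[|k] [t [// _ t_bnd pq]]].
have k0 := half_pow_gt0 k.+1; have k1 := half_pow_le1 k; rewrite half_powS in k1.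
have t1 : 2 ^- k.+1 + t != 1.
  by apply/eqP => e; apply: nq; right; right; exists 0;
    case: pq => [] [_ ->]; rewrite e expr0 invr1; tauto.
by case: pq => [] [_ ->]; split=> /=; rewrite ?lexx ?ltr01 // lt_neqAle t1 /=; lra.
Qed.

Lemma dyadic_segment_uniq k l (t u : R) :
  0 < t < 2 ^- k.+1 -> 0 < u < 2 ^- l.+1 ->
  dyadic_sum R k + t = dyadic_sum R l + u -> k = l.
Proof.
have mono i j (v w : R) : (i < j)%N -> v < 2 ^- i.+1 -> 0 < w ->
    dyadic_sum R i + v < dyadic_sum R j + w.
  move=> ij vi w0; rewrite !dyadic_sumE half_powS.
  have : 2 ^- j <= 2 ^- i.+1 :> R.
    by rewrite lef_pV2 ?posrE ?exprn_gt0 // ler_weXn2l // ler1n.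
  lra.
move=> /andP[t0 tk] /andP[u0 ul] e; case: (ltngtP k l) => // h.
- by have := mono _ _ _ _ h tk u0; rewrite e ltxx.
- by have := mono _ _ _ _ h ul t0; rewrite e ltxx.
Qed.

(** Segment endpoints are singular, so [p] is interior to a single segment; the top and right sides
    share only the singular corner [(1, 1)]. *)
Lemma glue_functional p q r : punctured_square R p ->
  Defs.glue p q -> Defs.glue p r -> q = r.
Proof.
move=> [_ np] [[|k] [t [// _ t_bnd pq]]] [[|l] [u [// _ u_bnd pr]]].
have interior n (v : R) : 0 <= v <= 2 ^- n.+1 ->
    p = (dyadic_sum R n + v, 1) \/ p = (1, dyadic_sum R n + v) ->
    0 < v < 2 ^- n.+1.
  rewrite !lt_neqAle => /andP[-> ->] pE; rewrite !andbT.
  apply/andP; split; apply/eqP => e; apply: np; right; right.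
    by exists n; case: pE => ->; rewrite -e addr0; tauto.
  have endE : dyadic_sum R n + v = dyadic_sum R n.+1.
    by rewrite e !dyadic_sumE (half_powS n); ring.
  by exists n.+1; case: pE => ->; rewrite endE; tauto.
have t_in : 0 < t < 2 ^- k.+1 by apply: interior => //; case: pq => -[-> _]; tauto.
have u_in : 0 < u < 2 ^- l.+1 by apply: interior => //; case: pr => -[-> _]; tauto.
case: pq pr => [] [-> ->] [] [] [] /=.
- move=> e -> ; have kl := dyadic_segment_uniq t_in u_in e.
  by move: e; rewrite kl => /addrI ->.
- move=> e1 e2 _; exfalso; rewrite dyadic_sumE half_powS in e1; lra.
- move=> e1 e2 _; exfalso; rewrite dyadic_sumE half_powS in e2; lra.
- move=> e -> ; have kl := dyadic_segment_uniq t_in u_in e.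
  by move: e; rewrite kl => /addrI ->.
Qed.

(* The invariant of the gluing relation is the set of points of the half-open
   square that are equal or glued to a given point. *)
Lemma chart_inj p q : punctured_square R p -> punctured_square R q ->
  half_open_square p -> half_open_square q -> chart p = chart q -> p = q.
Proof.
move=> Pp Pq Hp Hq /eqmodP /asboolP pq.
pose rep p r := p = r \/ Defs.glue p r.
have inv (x y : punctured_square R) :
    clos_refl_sym_trans _ (fun p q : punctured_square R => Defs.glue (val p) (val q)) x y ->
    forall r, half_open_square r -> (rep (val x) r <-> rep (val y) r).
  elim=> {x y} [x y xy r Hr|x r _|x y _ IH r Hr|x y z _ IH1 _ IH2 r Hr].
  - split=> [[xr|xr]|[yr|yr]].
    + by case: (glue_half_open_squareN xy); rewrite xr.
    + by left; apply: glue_functional xy xr; apply/set_mem/valP.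
    + by right; rewrite -yr.
    + case: (glue_half_open_squareN yr); apply: glue_half_open_square xy.
      by apply/set_mem/valP.
  - by [].
  - by rewrite IH.
  - by rewrite IH1 // IH2.
have := inv _ _ pq p Hp; rewrite !insubdK; [|exact/mem_set..].
case=> /(_ (or_introl erefl)) [-> //|qp _].
by case: (glue_half_open_squareN qp).
Qed.

(** Both halves are closed; the hypothesis at [2^-1] lets the first one include its right endpoint,
    where the path takes the value of [c2]. *)
Lemma glued_path_continuous (c1 c2 : R -> R * R) :
  continuous c1 -> continuous c2 ->
  (forall s, 0 <= s <= 2^-1 -> punctured_square R (c1 s)) ->
  (forall s, 2^-1 <= s <= 1 -> punctured_square R (c2 s)) ->
  chart (c1 2^-1) = chart (c2 2^-1) ->
  {within `[0, 1]%classic,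
    continuous (fun s => chart (if s < 2^-1 then c1 s else c2 s))}.
Proof.
move=> cont1 cont2 P1 P2 e12.
have -> : `[0, 1]%classic = `[0, 2^-1]%classic `|` `[2^-1, 1]%classic :> set R.
  apply/seteqP; split=> s /=; rewrite !in_itv /=; last by case=> ?; lra.
  by case: (lerP s 2^-1) => ? ?; [left|right]; lra.
apply: withinU_continuous; [exact: interval_closed..| |].
- apply: (@subspace_eq_continuous _ _ _ (chart \o c1)).
    move=> s; rewrite inE /= in_itv /= => /andP[s0 s1].
    rewrite /from_subspace; have [->|s_neq] := eqVneq s 2^-1; first by rewrite ltxx e12.
    by rewrite lt_neqAle s_neq s1.
  by apply: chart_continuous => // s; rewrite /= in_itv /=; exact: P1.
- apply: (@subspace_eq_continuous _ _ _ (chart \o c2)).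
    by move=> s; rewrite inE /= in_itv /= => /andP[s0 s1]; rewrite /from_subspace ltNge s0.
  by apply: chart_continuous => // s; rewrite /= in_itv /=; exact: P2.
Qed.

End chamanara_chart.

(** * Bit reversal and the odometer *)

Section bit_reversal.
Local Open Scope nat_scope.

Fixpoint bitrev (L n : nat) : nat :=
  if L is L'.+1 then n %% 2 * 2 ^ L' + bitrev L' (n %/ 2) else 0.

Lemma bitrev_lt L n : bitrev L n < 2 ^ L.
Proof.
elim: L n => //= L IHL n; have := IHL (n %/ 2).
have : n %% 2 < 2 by rewrite ltn_mod.
by rewrite expnS; nia.
Qed.

Lemma bitrev0 L : bitrev L 0 = 0.
Proof. by elim: L => //= L IHL; rewrite mod0n div0n. Qed.

(** Reversal also swaps the two digit blocks. The case [b = 1] gives [bitrevK], the case [a = b = m]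
    the exchange of rows and columns. *)
Lemma bitrev_cat a b r q : r < 2 ^ a ->
  bitrev (a + b) (r + 2 ^ a * q) = bitrev a r * 2 ^ b + bitrev b q.
Proof.
elim: a r => [|a IHa] r; first by rewrite expn0 ltnS leqn0 mul1n => /eqP ->.
move=> r_lt; rewrite addSn /= expnS -mulnA -modnDmr modnMr addn0.
rewrite divnDr ?dvdn_mulr // mulKn // IHa; first by rewrite expnD; nia.
by rewrite ltn_divLR // mulnC -expnS.
Qed.

Lemma bitrevK L n : n < 2 ^ L -> bitrev L (bitrev L n) = n.
Proof.
elim: L n => [|L IHL] n; first by rewrite expn0 ltnS leqn0 => /eqP ->.
move=> n_lt; rewrite [bitrev _ n]/= addnC mulnC -addn1 bitrev_cat ?bitrev_lt //.
rewrite IHL; last by rewrite ltn_divLR // mulnC -expnS.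
by rewrite /= modn_mod muln1 addn0 expn1 -divn_eq.
Qed.

Lemma bitrev_eq0 L n : n < 2 ^ L -> bitrev L n = 0 -> n = 0.
Proof. by move=> n_lt e; rewrite -(bitrevK n_lt) e bitrev0. Qed.

(** Values grow at least as fast as indices: counting from the first index bounds [h i] below,
    counting to the last one bounds it above. *)
Lemma ord_strict_mono_id N (h : 'I_N -> nat) : (forall i, h i < N) ->
  (forall i j : 'I_N, i < j -> h i < h j) -> forall i, h i = i.
Proof.
move=> h_lt h_mono.
have gap k (i j : 'I_N) : j = i + k :> nat -> h i + k <= h j.
  elim: k i j => [|k IHk] i j e.
    by rewrite addn0; have -> : i = j by apply/val_inj => /=; lia.
  have lt_ik : i + k < N by have := ltn_ord j; lia.
  have := IHk i (Ordinal lt_ik) erefl.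
  have /h_mono : Ordinal lt_ik < j by rewrite /= e addnS.
  lia.
move=> i; have N0 : 0 < N by case: i => i /=; exact: leq_ltn_trans.
have N1 : N.-1 < N by rewrite ltn_predL.
have /= := gap i (Ordinal N0) i (esym (add0n _)).
have /= := gap (N.-1 - i) i (Ordinal N1).
have := h_lt (Ordinal N1); have := ltn_ord i; lia.
Qed.

End bit_reversal.

(** * The odometer on van der Corput values *)

Section odometer.
Variable R : realType.

Lemma vdcorput_bitrev L n : (n < 2 ^ L)%N ->
  vdcorput R n = (bitrev L n)%:R / 2 ^+ L.
Proof.
elim: L n => [|L IHL] n n_lt.
  by move: n_lt; rewrite expn0 ltnS leqn0 => /eqP ->; rewrite /vdcorput big_ord0 mul0r.
rewrite vdcorput_half IHL; last by rewrite ltn_divLR // mulnC -expnS.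
rewrite /= natrD natrM natrX exprS.
have := exprn_gt0 L (ltr0n R 2) => h; field.
by rewrite gt_eqF // andbT pnatr_eq0.
Qed.

Lemma vdcorput_le L n : (n < 2 ^ L)%N -> vdcorput R n <= 1 - 2 ^- L.
Proof.
move=> n_lt; have h : 0 < 2 ^+ L :> R by rewrite exprn_gt0.
rewrite (vdcorput_bitrev n_lt) ler_pdivrMr // mulrBl mul1r mulVf ?gt_eqF //.
by rewrite lerBrDr natr1 -natrX ler_nat bitrev_lt.
Qed.

(* The von Neumann-Kakutani odometer, which is how the top (right) side of the
   square is glued to the bottom (left) side. *)
Definition odometer (x y : R) : Prop :=
  exists k t, [/\ (1 <= k)%N, 0 <= t <= 2 ^- k,
    x = dyadic_sum R k.-1 + t & y = 2 ^- k + t].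

Lemma odometer_glue_top x y : odometer x y -> Defs.glue (x, 1) (y, 0).
Proof. by case=> k [t [k1 tk -> ->]]; exists k, t; split=> //; left. Qed.

(** If [q] is even, the successor sets the first digit after the binary point, a translation by 1/2.
    If [q] is odd, this digit is cleared and the carry is the same problem at half scale, for
    [q %/ 2] and [2 * e]. *)
Lemma odometer_vdcorput m q (e : R) : (q.+1 < 2 ^ m)%N -> 0 <= e <= 2 ^- m ->
  odometer (vdcorput R q + e) (vdcorput R q.+1 + e).
Proof.
elim: m q e => [|m IHm] q e; first by rewrite expn0 ltnS.
move=> q_lt /andP[e0 e1]; have e2 := half_powS R m.
have p_lt : (q %/ 2 < 2 ^ m)%N by rewrite ltn_divLR // mulnC -expnS ltnW.
rewrite vdcorput_half (vdcorput_half R q.+1).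
have : (q %% 2 = 0 /\ q.+1 %% 2 = 1 /\ q.+1 %/ 2 = q %/ 2 \/
        q %% 2 = 1 /\ q.+1 %% 2 = 0 /\ q.+1 %/ 2 = (q %/ 2).+1)%N by lia.
case=> [] [-> [-> eq1]]; rewrite eq1.
  have := vdcorput_le p_lt; have /andP[v0 _] := vdcorput_bound R (q %/ 2) => v1.
  exists 1, (vdcorput R (q %/ 2)%N / 2 + e); rewrite dyadic_sumE /= expr0 expr1 invr1.
  by split=> //; lra.
have [||k [t [k1 tk ex ey]]] := IHm (q %/ 2)%N (2 * e).
- by move: q_lt eq1; rewrite expnS; lia.
- lra.
exists k.+1, (t / 2); split=> //.
- by rewrite (half_powS R k) in tk; lra.
- case: k k1 tk ex ey => // k _ tk; rewrite /= !dyadic_sumE (half_powS R k); lra.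
- rewrite (half_powS R k) in ey; lra.
Qed.

End odometer.

(** Below [2 ^ L] the values are ordered like the reversed integers, so [bitrev L] after [sort_perm]
    is strictly increasing, hence the identity. *)
Lemma sort_perm_vdcorput (R : realType) L N (i : 'I_N) : N = (2 ^ L)%N ->
  sort_perm (vdcorput R) i = bitrev L i :> nat.
Proof.
move=> NE; have lt_N (j : 'I_N) : (j < 2 ^ L)%N by rewrite -NE ltn_ord.
rewrite -(bitrevK (lt_N (sort_perm _ i))); congr bitrev.
move: i; apply: ord_strict_mono_id => [i|i j ij].
  by have := bitrev_lt L (sort_perm (vdcorput R) i); rewrite -NE.
have := sort_perm_lt (@vdcorput_inj R) ij.
rewrite !(vdcorput_bitrev R (lt_N _)) ltr_pM2r ?invr_gt0 ?exprn_gt0 //.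
by rewrite ltr_nat.
Qed.

(** * Grid coordinates of a vertex and of its successor *)

Section grid.
Local Open Scope nat_scope.
Variable m : nat.

Definition grid_row (n : nat) := n %% 2 ^ m.
Definition grid_col (n : nat) := bitrev m (n %/ 2 ^ m).

Let M_gt0 : 0 < 2 ^ m. Proof. by rewrite expn_gt0. Qed.
Let NE : 4 ^ m = 2 ^ m * 2 ^ m. Proof. by rewrite -expnMn. Qed.

Lemma grid_row_lt n : grid_row n < 2 ^ m.
Proof. by rewrite ltn_mod. Qed.

Lemma grid_col_lt n : grid_col n < 2 ^ m.
Proof. exact: bitrev_lt. Qed.

Lemma div_grid_lt n : n < 4 ^ m -> n %/ 2 ^ m < 2 ^ m.
Proof. by rewrite NE ltn_divLR. Qed.

Lemma grid_inj n n' : n < 4 ^ m -> n' < 4 ^ m ->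
  grid_col n = grid_col n' -> grid_row n = grid_row n' -> n = n'.
Proof.
move=> /div_grid_lt n_lt /div_grid_lt n'_lt ec er.
rewrite (divn_eq n (2 ^ m)) (divn_eq n' (2 ^ m)); congr (_ * _ + _) => //.
by rewrite -(bitrevK n_lt) -(bitrevK n'_lt); congr bitrev.
Qed.

Lemma bitrev_grid n : n < 4 ^ m ->
  bitrev (m + m) n = bitrev m (grid_row n) * 2 ^ m + grid_col n.
Proof.
move=> n_lt; rewrite {1}(divn_eq n (2 ^ m)) addnC mulnC bitrev_cat //.
by rewrite ltn_mod.
Qed.

(** The quotient of the reversed number by [2 ^ m] is the reversed row, which [grid_col] reverses
    back. *)
Lemma grid_col_bitrev n : n < 4 ^ m -> grid_col (bitrev (m + m) n) = grid_row n.
Proof.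
move=> n_lt; rewrite (bitrev_grid n_lt) /grid_col divnMDl //.
by rewrite divn_small ?bitrev_lt // addn0 bitrevK // grid_row_lt.
Qed.

Lemma grid_row_bitrev n : n < 4 ^ m -> grid_row (bitrev (m + m) n) = grid_col n.
Proof.
by move=> n_lt; rewrite (bitrev_grid n_lt) /grid_row modnMDl modn_small // grid_col_lt.
Qed.

Lemma grid_row_succ n : (grid_row n).+1 < 2 ^ m -> grid_row n.+1 = (grid_row n).+1.
Proof. by move=> h; rewrite /grid_row -addn1 -modnDml addn1 modn_small. Qed.

Lemma grid_col_succ n : (grid_row n).+1 < 2 ^ m -> grid_col n.+1 = grid_col n.
Proof.
move=> h; rewrite /grid_col; congr bitrev; rewrite {1}(divn_eq n (2 ^ m)) -addnS.
by rewrite divnMDl // (divn_small h) addn0.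
Qed.

Lemma div_succ_last n : (grid_row n).+1 = 2 ^ m -> n.+1 %/ 2 ^ m = (n %/ 2 ^ m).+1.
Proof.
move=> h; rewrite {1}(divn_eq n (2 ^ m)) -addnS -/(grid_row n) h.
by rewrite divnMDl // divnn M_gt0 addn1.
Qed.

Lemma grid_row_succ_last n : (grid_row n).+1 = 2 ^ m -> grid_row n.+1 = 0.
Proof. by move=> h; rewrite /grid_row -addn1 -modnDml -/(grid_row n) addn1 h modnn. Qed.

(** Only the quotient 0 gives column 0, and here the quotient is a successor. So column 0 is entered
    from below by the last edge alone. *)
Lemma grid_col_succ_last_gt0 n : n.+1 < 4 ^ m -> (grid_row n).+1 = 2 ^ m -> 0 < grid_col n.+1.
Proof.
move=> n_lt h; rewrite lt0n; apply/eqP => /(bitrev_eq0 (div_grid_lt n_lt)).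
by rewrite div_succ_last.
Qed.

Lemma grid_succ_lt n : n < 4 ^ m -> (grid_row n).+1 < 2 ^ m -> n.+1 < 4 ^ m.
Proof.
move=> n_lt h; rewrite ltn_neqAle n_lt andbT; apply/eqP => e.
by have := grid_row_succ h; rewrite e NE /grid_row modnMl.
Qed.

Lemma grid_last : grid_col (4 ^ m).-1 = (2 ^ m).-1 /\ (grid_row (4 ^ m).-1).+1 = 2 ^ m.
Proof.
have e : (4 ^ m).-1 = (2 ^ m).-1 * 2 ^ m + (2 ^ m).-1 by rewrite NE; nia.
have M1 : (2 ^ m).-1 < 2 ^ m by rewrite ltn_predL.
split; last by rewrite e /grid_row modnMDl modn_small // prednK.
rewrite e /grid_col divnMDl // divn_small // addn0.
have aux L : bitrev L (2 ^ L).-1 = (2 ^ L).-1.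
  elim: L => //= L IHL; have L0 : 0 < 2 ^ L by rewrite expn_gt0.
  have -> : (2 ^ L.+1).-1 = (2 ^ L).-1 * 2 + 1 by rewrite expnS; lia.
  by rewrite modnMDl divnMDl // addn0 IHL /=; lia.
exact: aux.
Qed.

Lemma grid0 : grid_col 0 = 0 /\ grid_row 0 = 0.
Proof. by rewrite /grid_col /grid_row div0n mod0n bitrev0. Qed.

End grid.

(** * Reflection in the diagonal *)

Section flip.
Variable R : realType.
Implicit Types p q : R * R.

Definition flip (b : bool) p := if b then (p.2, p.1) else p.

Lemma flipK b : involutive (flip b).
Proof. by case: b => -[]. Qed.

Lemma flip_half_open b p : half_open_square p -> half_open_square (flip b p).
Proof. by case: b => // -[]. Qed.

Lemma flip_punctured b p : punctured_square R p -> punctured_square R (flip b p).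
Proof.
case: b p => // -[x y] [[hx hy] np]; split=> //= sp; apply: np.
case: sp => [[-> ->]|[[-> ->]|[k h]]]; [by left|by right; left|right; right].
by exists k; case: h => [|[|[]]] [-> ->]; tauto.
Qed.

Lemma flip_glue b p q : Defs.glue p q -> Defs.glue (flip b p) (flip b q).
Proof.
case: b => // -[k [t [k1 tk h]]]; exists k, t; split=> //.
by case: h => [] [-> ->]; [right|left].
Qed.

Lemma flip_continuous b (c : R -> R * R) : continuous c ->
  continuous (flip b \o c).
Proof.
case: b => // c_cont.
have c1 : continuous (fun s => (c s).1).
  by move=> s; exact: (cvg_comp _ _ (c_cont s) cvg_fst).
have c2 : continuous (fun s => (c s).2).
  by move=> s; exact: (cvg_comp _ _ (c_cont s) cvg_snd).
by move=> s; exact: (cvg_pair (c2 s) (c1 s)).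
Qed.

End flip.

(** * The grid drawing *)

Section drawing.
Variables (R : realType) (m : nat).
Local Notation M := (2 ^ m)%N.
Local Notation N := (4 ^ m)%N.
Local Notation Mr := ((2 ^ m)%N%:R : R).

(* The grid of M * M vertices is drawn in the coordinates [pt], in which the
   unit square is [0, 4M] x [0, 4M]. *)
Definition mesh : R := 2 ^- m.+2.
Definition pt (X Y : R) : R * R := (mesh * X, mesh * Y).

Lemma mesh_gt0 : 0 < mesh.
Proof. exact: half_pow_gt0. Qed.

Lemma mesh4 : mesh * (4 * Mr) = 1.
Proof.
rewrite /mesh natrX 2!exprS.
have h : 2 ^+ m != 0 :> R by rewrite gt_eqF // exprn_gt0.
by field; rewrite h.
Qed.

Lemma mesh_lt1 X : (mesh * X < 1) = (X < 4 * Mr).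
Proof. by rewrite -[X in _ < X]mesh4 ltr_pM2l ?mesh_gt0. Qed.

Lemma mesh_gt0E X : (0 < mesh * X) = (0 < X).
Proof. by rewrite pmulr_rgt0 ?mesh_gt0. Qed.

Lemma mesh_ge0E X : (0 <= mesh * X) = (0 <= X).
Proof. by rewrite pmulr_rge0 ?mesh_gt0. Qed.

Lemma pt_inj X Y X' Y' : pt X Y = pt X' Y' -> X = X' /\ Y = Y'.
Proof.
by case=> /mulfI eX /mulfI eY; split; [apply: eX|apply: eY]; rewrite gt_eqF ?mesh_gt0.
Qed.

Lemma pt_half_open X Y : 0 <= X < 4 * Mr -> 0 <= Y < 4 * Mr ->
  half_open_square (pt X Y).
Proof. by move=> hX hY; split=> /=; rewrite mesh_ge0E mesh_lt1. Qed.

(** * Avoiding the singular points *)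

Lemma pt_punctured_inside X Y : 0 < X < 4 * Mr -> 0 < Y < 4 * Mr ->
  punctured_square R (pt X Y).
Proof.
rewrite -!mesh_lt1 -(mesh_gt0E X) -(mesh_gt0E Y) => hX hY.
split; first by split=> /=; lra.
by case=> [[]|[[]|[k [|[|[|]]] []]]]; lra.
Qed.

(** Otherwise the odd [j > 1] would divide [2 ^ m.+2]. *)
Lemma mesh_odd_neq_pow2 j k : odd j -> (1 < j)%N -> mesh * j%:R <> 2 ^- k.
Proof.
move=> oj j1 e; have : (j * 2 ^ k = 2 ^ m.+2)%N.
  apply/eqP; rewrite -(eqr_nat R) natrM !natrX; apply/eqP.
  have h n : 2 ^+ n != 0 :> R by rewrite gt_eqF // exprn_gt0.
  apply: (mulfI (invr_neq0 (h m.+2))); rewrite -/mesh mulrA e mulVf //.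
  by rewrite /mesh mulVf.
move=> /(congr1 (fun n => j %| n)%N); rewrite dvdn_mulr // => /esym jd.
have : coprime j (2 ^ m.+2) by rewrite coprimeXr // coprimen2.
by rewrite /coprime (gcdn_idPl jd) => /eqP j_eq; rewrite j_eq in j1.
Qed.

Lemma pt_punctured_bottom j : odd j -> (1 < j)%N -> j%:R < 4 * Mr ->
  punctured_square R (pt j%:R 0).
Proof.
move=> oj j1 jM; have j0 : 0 < j%:R :> R by rewrite ltr0n ltnW.
move: (jM) (j0); rewrite -mesh_lt1 -mesh_gt0E => h1 h0.
rewrite /pt mulr0; split; first by split=> /=; lra.
case=> [[]|[[]|[k [|[|[|]]] []]]]; try lra.
by move=> e; exact: mesh_odd_neq_pow2 e.
Qed.

Lemma pt_punctured_top c : (c < M)%N ->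
  punctured_square R (pt (4 * c%:R + 1) (4 * Mr)).
Proof.
move=> cM; have c0 : 0 <= c%:R :> R by [].
have cMr : c%:R + 1 <= Mr by rewrite natr1 ler_nat.
have h1 : mesh * (4 * c%:R + 1) < 1 by rewrite mesh_lt1; lra.
have h0 : 0 < mesh * (4 * c%:R + 1) by rewrite mesh_gt0E; lra.
rewrite /pt mesh4; split; first by split=> /=; lra.
case=> [[]|[[]|[k [|[|[|]]] []]]]; try lra.
(* Measured from the right end, the point is at [4 * (M - c) - 1] units, odd and at least 3, and the
   singular point at distance [2 ^- k]. *)
rewrite dyadic_sumE => e; apply: (@mesh_odd_neq_pow2 (4 * (M - c) - 1) k); [lia|lia|].
rewrite natrB; last by lia.
rewrite natrM natrB; last by lia.
by rewrite mulrBr mulrBr mulrBr mesh4; move: e; rewrite mulrDr; lra.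
Qed.

(** * The arcs of the first cycle *)

Definition ray (a b c d s : R) : R * R := pt (a + b * s) (c + d * s).

Lemma ray_continuous a b c d : continuous (ray a b c d).
Proof.
have aff (e f : R) : continuous (fun s : R => mesh * (e + f * s)).
  move=> s; apply: cvgM; first exact: cvg_cst.
  apply: cvgD; first exact: cvg_cst.
  by apply: cvgM; [exact: cvg_cst|exact: cvg_id].
by move=> s; apply: (cvg_pair (aff a b s) (aff c d s)).
Qed.

(** The offset 1 in cells of side 4 makes the column lines miss the singular points, except for
    column 0 at the bottom, and leaves the abscissa 3 free for the last edge. *)
Definition pos (n : nat) : R * R :=
  pt (4 * (grid_col m n)%:R + 1) (4 * (grid_row m n)%:R + 1).

(* In the last row the arc covers the remaining 3 units to the top side in time
   1/2. *)
Definition slope (i : nat) : R := if ((grid_row m i).+1 < M)%N then 4 else 6.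

Definition vstart (i : nat) : R -> R * R :=
  ray (4 * (grid_col m i)%:R + 1) 0 (4 * (grid_row m i)%:R + 1) (slope i).

(* The edge from N - 1 to 0 is the only slanted one: it comes back at (3, 0), in
   the right half of the cell of the vertex 0, which is placed at (1, 1). *)
Definition vend (i : nat) : R -> R * R :=
  if ((grid_row m i).+1 < M)%N then vstart i
  else if (i.+1 < N)%N then ray (4 * (grid_col m i.+1)%:R + 1) 0 (-1) 2
  else ray 5 (-4) (-1) 2.

Definition vpath (i : nat) (s : R) : R * R :=
  if s < 2^-1 then vstart i s else vend i s.

Lemma vstart_continuous i : continuous (vstart i).
Proof. exact: ray_continuous. Qed.

Lemma vend_continuous i : continuous (vend i).
Proof.
by rewrite /vend; case: ifP => _; [|case: ifP => _]; exact: ray_continuous.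
Qed.

Lemma vpath0 i : vpath i 0 = pos i.
Proof. by rewrite /vpath invr_gt0 ltr0n /= /vstart /ray !mulr0 !addr0. Qed.

Lemma rowMr i : (grid_row m i)%:R + 1 <= Mr.
Proof. by rewrite natr1 ler_nat grid_row_lt. Qed.

Lemma colMr i : (grid_col m i)%:R + 1 <= Mr.
Proof. by rewrite natr1 ler_nat grid_col_lt. Qed.

Lemma grid_row_last i : ((grid_row m i).+1 < M)%N = false -> (grid_row m i).+1 = M.
Proof. by move=> h; have := grid_row_lt m i; lia. Qed.

Lemma rowMr_last i : ((grid_row m i).+1 < M)%N = false -> Mr = (grid_row m i)%:R + 1.
Proof. by move=> /grid_row_last h; rewrite natr1 h. Qed.

Lemma rowMr_inner i : ((grid_row m i).+1 < M)%N -> (grid_row m i)%:R + 2 <= Mr.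
Proof. by move=> h; rewrite -natrD ler_nat addn2. Qed.

Lemma vpath1 i : (i < N)%N -> vpath i 1 = pos (i.+1 %% N).
Proof.
move=> i_lt; rewrite /vpath ltNge invf_le1 // ler1n /= /vend.
case: ifP => [h|/grid_row_last h].
  rewrite modn_small ?(grid_succ_lt i_lt) // /pos grid_row_succ // grid_col_succ //.
  by rewrite -[(grid_row m i).+1%:R]natr1 /vstart /ray /slope h; congr pt; ring.
case: ifP => [h'|h'].
  rewrite modn_small // /pos grid_row_succ_last // /ray; congr pt; ring.
have -> : i.+1 = N by lia.
have [c0 r0] := grid0 m.
by rewrite modnn /pos c0 r0 /ray; congr pt; ring.
Qed.

Lemma vstart_punctured i s : 0 <= s <= 2^-1 -> punctured_square R (vstart i s).
Proof.
move=> s_bnd; have c1 := colMr i; have r1 := rowMr i.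
have c0 : 0 <= (grid_col m i)%:R :> R by []. have r0 : 0 <= (grid_row m i)%:R :> R by [].
rewrite /vstart /ray mul0r addr0 /slope; case: ifP => [h|/rowMr_last rM].
  by apply: pt_punctured_inside; lra.
have [->|s_neq] := eqVneq s 2^-1.
  have -> : 4 * (grid_row m i)%:R + 1 + 6 * 2^-1 = 4 * Mr by rewrite rM; field.
  by apply: pt_punctured_top; exact: grid_col_lt.
have s_lt : s < 2^-1 by rewrite lt_neqAle s_neq; case/andP: s_bnd.
by apply: pt_punctured_inside; lra.
Qed.

Lemma vend_punctured i s : 2^-1 <= s <= 1 -> punctured_square R (vend i s).
Proof.
move=> s_bnd; rewrite /vend; case: ifP => [h|h].
  have c1 := colMr i; have r1 := rowMr_inner h.
  have c0 : 0 <= (grid_col m i)%:R :> R by []. have r0 : 0 <= (grid_row m i)%:R :> R by [].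
  by rewrite /vstart /ray mul0r addr0 /slope h; apply: pt_punctured_inside; lra.
have M1 : 1 <= Mr by rewrite ler1n expn_gt0.
have [->|s_neq] := eqVneq s 2^-1.
  rewrite /ray; case: ifP => h'.
    (* A positive column gives [4 * c + 1 > 1], which excludes the singular point at [mesh]
       itself. *)
    have := grid_col_succ_last_gt0 h' (grid_row_last h) => c_gt0; have c1 := colMr i.+1.
    rewrite mul0r addr0; have -> : -1 + 2 / 2 = 0 :> R by field.
    rewrite -natrM natr1; apply: pt_punctured_bottom; [lia|lia|].
    by rewrite -natr1 natrM; lra.
  have -> : -1 + 2 / 2 = 0 :> R by field.
  have -> : 5 + -4 / 2 = 3%:R :> R by field.
  by apply: pt_punctured_bottom => //; lra.
have s_lt : 2^-1 < s by rewrite lt_neqAle eq_sym s_neq; case/andP: s_bnd.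
have c1 := colMr i.+1; have c0 : 0 <= (grid_col m i.+1)%:R :> R by [].
by rewrite /ray; case: ifP => _; apply: pt_punctured_inside; lra.
Qed.

Lemma vstart_vend_glue i : (i < N)%N ->
  vstart i 2^-1 = vend i 2^-1 \/ Defs.glue (vstart i 2^-1) (vend i 2^-1).
Proof.
move=> i_lt; rewrite /vend; case: ifP => [_|h]; [by left|right].
have m0 := mesh_gt0.
have meshE : 2 ^- m = mesh * 4 by rewrite (half_powS R m) (half_powS R m.+1) /mesh; ring.
have -> : vstart i 2^-1 = (mesh * (4 * (grid_col m i)%:R + 1), 1).
  rewrite /vstart /ray /slope h mul0r addr0 /pt; congr pair.
  rewrite -[RHS]mesh4 (rowMr_last h); congr (_ * _); by field.
have bottom : mesh * (-1 + 2 / 2) = 0 by field.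
case h' : (i.+1 < N)%N; rewrite /ray /pt bottom; apply: odometer_glue_top.
  have q_lt : ((i %/ M).+1 < 2 ^ m)%N.
    by rewrite -(div_succ_last (grid_row_last h)) div_grid_lt.
  (* Columns have width [4 * mesh = 2 ^- m], so each starts at a van der Corput value, and its line
     has offset [mesh]. *)
  have colE n : (n < N)%N ->
      mesh * (4 * (grid_col m n)%:R + 1) = vdcorput R (n %/ M) + mesh.
    by move=> /div_grid_lt n_lt; rewrite (vdcorput_bitrev R n_lt) meshE /grid_col; ring.
  rewrite mul0r addr0 (colE i i_lt) (colE i.+1 h') (div_succ_last (grid_row_last h)).
  by apply: odometer_vdcorput q_lt _; rewrite meshE; lra.
have iE : i = N.-1 by lia.
have [cE _] := grid_last m.
(* The last column starts at [dyadic_sum m], as does the top segment [m.+1]. Its bottom copy starts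
   at [2 ^- m.+1 = 2 * mesh], and the offset [mesh] leads to the abscissa 3. *)
exists m.+1, mesh; rewrite /= dyadic_sumE iE cE.
have half2 : 2 ^- m.+1 = mesh * 2 by rewrite (half_powS R m.+1) /mesh; ring.
have cM : (M.-1)%:R = Mr - 1 by rewrite -subn1 natrB // expn_gt0.
split=> //; rewrite ?half2 ?meshE ?cM; [lra| |by field].
by rewrite mulrDr mulrBr mulrBr mesh4; ring.
Qed.

(** For [s < 1] the two returning shapes stay at [Y < 1], below all vertices, and [VpathUp] stays
    strictly between two row lines; the equations recover [s]. *)
Variant vpath_spec (i : nat) (s X Y : R) : Prop :=
| VpathUp of X = 4 * (grid_col m i)%:R + 1
    & 4 * (grid_row m i)%:R + 1 < Y < 4 * (grid_row m i)%:R + 5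
    & Y = 4 * (grid_row m i)%:R + 1 + slope i * s
| VpathDown of (grid_row m i).+1 = M & (i.+1 < N)%N
    & X = 4 * (grid_col m i.+1)%:R + 1 & 2^-1 <= s & Y = 2 * s - 1
| VpathLast of i.+1 = N & X = 5 - 4 * s & 2^-1 <= s & Y = 2 * s - 1.

Lemma slope_gt0 i : 0 < slope i.
Proof. by rewrite /slope; case: ifP. Qed.

Lemma vpathP i s : (i < N)%N -> 0 < s < 1 ->
  exists X Y, [/\ vpath i s = pt X Y, vpath_spec i s X Y,
    0 <= X < 4 * Mr & 0 <= Y < 4 * Mr].
Proof.
move=> i_lt s_bnd.
have c1 := colMr i; have r1 := rowMr i.
have c0 : 0 <= (grid_col m i)%:R :> R by [].
have r0 : 0 <= (grid_row m i)%:R :> R by [].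
have c1' := colMr i.+1; have c0' : 0 <= (grid_col m i.+1)%:R :> R by [].
have M1 : 1 <= Mr by rewrite ler1n expn_gt0.
have inner : (s < 2^-1) || ((grid_row m i).+1 < M)%N ->
    exists X Y, [/\ vstart i s = pt X Y, vpath_spec i s X Y,
      0 <= X < 4 * Mr & 0 <= Y < 4 * Mr].
  move=> h; rewrite /vstart /ray mul0r addr0; do 2 eexists; split; first reflexivity.
  - apply: VpathUp => //; move: h; rewrite /slope; case: ifP => _; rewrite ?orbF; lra.
  - lra.
  - move: h; rewrite /slope; case: ifP => [/(rowMr_inner)|_]; rewrite ?orbF; lra.
rewrite /vpath; case: ifP => [h|h]; first by apply: inner; rewrite h.
have s2 : 2^-1 <= s by rewrite leNgt h.
rewrite /vend; case: ifP => [h'|h']; first by apply: inner; rewrite h' orbT.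
case: ifP => h''; rewrite /ray; do 2 eexists; split; try reflexivity; try lra.
- by apply: VpathDown => //; [exact: grid_row_last|ring|ring].
- by apply: VpathLast => //; [lia|ring|ring].
Qed.

(** * Separation of the arcs *)

Lemma vpath_spec_ge1 i s X Y : s < 1 -> vpath_spec i s X Y -> 1 <= X.
Proof.
move=> s1; have c0 n : 0 <= (grid_col m n)%:R :> R by [].
by case=> *; have := c0 i; have := c0 i.+1; lra.
Qed.

Lemma vpath_spec_up i s X Y : s < 1 -> vpath_spec i s X Y -> 1 <= Y ->
  X = 4 * (grid_col m i)%:R + 1 /\
  4 * (grid_row m i)%:R + 1 < Y < 4 * (grid_row m i)%:R + 5.
Proof. by move=> s1 []; [|lra..]. Qed.

Lemma grid_line_gap (a b : nat) :
  ~ 4 * a%:R + 1 < (4 * b%:R + 1 : R) < 4 * a%:R + 5.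
Proof.
move=> h; have : (a < b)%N by rewrite -(ltr_nat R); lra.
have : (b < a.+1)%N by rewrite -(ltr_nat R) -natr1; lra.
by lia.
Qed.

Lemma grid_line_inj (a b : nat) : 4 * a%:R + 1 = 4 * b%:R + 1 :> R -> a = b.
Proof. by move=> h; apply/eqP; rewrite -(eqr_nat R); apply/eqP; lra. Qed.

(** An ordinate of at least 1 forces the rising part, strictly between two row lines. Here [b]
    serves as a row or, for reflected vertices, as a column. *)
Lemma vpath_spec_not_vertex i s X (b : nat) : s < 1 ->
  ~ vpath_spec i s X (4 * b%:R + 1).
Proof.
move=> s1 h; have b0 : 0 <= b%:R :> R by [].
have [|_] := vpath_spec_up s1 h; first by lra.
exact: grid_line_gap.
Qed.

(** Both abscissas are at least 1, so a crossing lies on both rising parts. The reflected arc then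
    runs along a row line, while the other is strictly between two of them. *)
Lemma vpath_spec_not_swap i j s t X Y : s < 1 -> t < 1 ->
  vpath_spec i s X Y -> ~ vpath_spec j t Y X.
Proof.
move=> s1 t1 h h'.
have [_] := vpath_spec_up s1 h (vpath_spec_ge1 t1 h').
have [-> _] := vpath_spec_up t1 h' (vpath_spec_ge1 s1 h).
exact: grid_line_gap.
Qed.

Lemma vpath_spec_inj i j s t X Y : (i < N)%N -> (j < N)%N -> s < 1 -> t < 1 ->
  vpath_spec i s X Y -> vpath_spec j t X Y -> i = j /\ s = t.
Proof.
move=> i_lt j_lt s1 t1.
have r0 n : 0 <= (grid_row m n)%:R :> R by [].
case=> [Xi Yi Yis|ri i_succ Xi s2 Yis|iN Xi s2 Yis];
  case=> [Xj Yj Yjt|rj j_succ Xj t2 Yjt|jN Xj t2 Yjt];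
  try (by have := r0 i; have := r0 j; lra).
- have ec : grid_col m i = grid_col m j by apply: grid_line_inj; rewrite -Xi.
  have er : grid_row m i = grid_row m j.
    apply/eqP; rewrite eqn_leq -ltnS -[X in _ && X]ltnS -!(ltr_nat R) -!natr1.
    by apply/andP; split; lra.
  have eij := grid_inj i_lt j_lt ec er; split=> //.
  apply: (mulfI (lt0r_neq0 (slope_gt0 j))); apply: (addrI (4 * (grid_row m j)%:R + 1)).
  by rewrite -Yjt Yis eij.
- split; last by lra.
  suff [] : i.+1 = j.+1 by [].
  apply: (grid_inj i_succ j_succ); last by rewrite !grid_row_succ_last.
  by apply: grid_line_inj; rewrite -Xi.
(* A vertical returning arc has abscissa at least 5, the slanted one at most 3. *)
- have c1 : 1 <= (grid_col m i.+1)%:R :> R by rewrite ler1n grid_col_succ_last_gt0.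
  lra.
- have c1 : 1 <= (grid_col m j.+1)%:R :> R by rewrite ler1n grid_col_succ_last_gt0.
  lra.
- by split; [lia|lra].
Qed.

Lemma pos_inside n :
  punctured_square R (pos n) /\ half_open_square (pos n).
Proof.
have := colMr n; have := rowMr n.
have : 0 <= (grid_col m n)%:R :> R by []. have : 0 <= (grid_row m n)%:R :> R by [].
by split; [apply: pt_punctured_inside|apply: pt_half_open]; lra.
Qed.

Lemma pos_bitrev n : (n < 4 ^ m)%N ->
  pos (bitrev (m + m) n) = flip true (pos n).
Proof. by move=> n_lt; rewrite /pos grid_col_bitrev // grid_row_bitrev. Qed.

Lemma vpath_inside i (s : R) : (i < 4 ^ m)%N -> 0 < s < 1 ->
  punctured_square R (vpath i s) /\ half_open_square (vpath i s).
Proof.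
move=> i_lt s_bnd; split; last first.
  by have [X [Y [-> _ hX hY]]] := vpathP i_lt s_bnd; exact: pt_half_open.
rewrite /vpath; case: ltrP => s2.
- by apply: vstart_punctured; lra.
- by apply: vend_punctured; lra.
Qed.

End drawing.

Theorem theorem1p3 (R : realType) (m : nat) (hm : (1 <= m)%N) :
  embeddable R (sequence_graph (vdcorput R) (4 ^ m)) (chamanara R).
Proof.
have NE : (4 ^ m = 2 ^ (m + m))%N by rewrite expnD -expnMn.
exists (fun v : 'I_(4 ^ m) => chart (pos R m v)).
exists (fun (e : bool * 'I_(4 ^ m)) s => chart (flip e.1 (vpath m e.2 s))).
(* Sorting reflects the grid, so a reflected arc joins consecutive vertices of the sorted order. *)
have vertexE (v : 'I_(4 ^ m)) :
    pos R m (sort_perm (vdcorput R) v) = flip true (pos R m v).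
  by rewrite (sort_perm_vdcorput R v NE) pos_bitrev.
split.
- move=> v w /= e; have [P H] := pos_inside R m v; have [P' H'] := pos_inside R m w.
  have [ec er] := pt_inj (chart_inj P P' H H' e).
  by apply: val_inj; apply: (grid_inj (ltn_ord v) (ltn_ord w)); exact: (@grid_line_inj R).
- case=> b i /=.
  have -> : (fun s : R => chart (flip b (vpath m i s))) = (fun s => chart
      (if s < 2^-1 then (flip b \o vstart m i) s else (flip b \o vend m i) s)).
    by apply/funext => s; rewrite /vpath; case: ifP.
  apply: glued_path_continuous.
  + by apply: flip_continuous; exact: vstart_continuous.
  + by apply: flip_continuous; exact: vend_continuous.
  + by move=> s s_bnd; apply: flip_punctured; exact: vstart_punctured.
  + by move=> s s_bnd; apply: flip_punctured; exact: vend_punctured.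
  + case: (vstart_vend_glue R (ltn_ord i)) => [/= -> //|h].
    apply: chart_glue; last exact: flip_glue.
      by apply: flip_punctured; apply: vstart_punctured; lra.
    by apply: flip_punctured; apply: vend_punctured; lra.
- case=> -[] i /=; rewrite vpath0 vpath1 // ?vertexE //.
- case=> b i v s s_bnd /= e.
  have [P H] := vpath_inside (ltn_ord i) s_bnd.
  have [P' H'] := pos_inside R m v.
  (* Both points lie in the half-open square, so the equality on the surface lifts to the plane. *)
  have {}e : flip b (vpath m i s) = pos R m v.
    by apply: chart_inj e => //; [exact: flip_punctured|exact: flip_half_open].
  have {}e : vpath m i s = flip b (pos R m v) by rewrite -e flipK.
  have [X [Y [e' spec _ _]]] := vpathP (ltn_ord i) s_bnd.
  case/andP: s_bnd => _ s1; move: e; rewrite e'.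
  by case: b => /pt_inj [_ eY]; rewrite eY in spec;
    exact: (vpath_spec_not_vertex s1 spec).
- case=> b i [b' j] s t s_bnd t_bnd /= e.
  have [P H] := vpath_inside (ltn_ord i) s_bnd.
  have [P' H'] := vpath_inside (ltn_ord j) t_bnd.
  have {}e : flip b (vpath m i s) = flip b' (vpath m j t).
    by apply: chart_inj e; try exact: flip_punctured; exact: flip_half_open.
  have [X [Y [eX specX _ _]]] := vpathP (ltn_ord i) s_bnd.
  have [X' [Y' [eX' specX' _ _]]] := vpathP (ltn_ord j) t_bnd.
  case/andP: s_bnd => _ s1; case/andP: t_bnd => _ t1.
  have [eb|neq_b] := eqVneq b b'.
    move: e; rewrite eb => /(inv_inj (flipK b')); rewrite eX eX' => /pt_inj [eXX eYY].
    rewrite -eXX -eYY in specX'.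
    have [eij ->] := vpath_spec_inj (ltn_ord i) (ltn_ord j) s1 t1 specX specX'.
    by split=> //; rewrite (val_inj eij).
  (* The arcs belong to different cycles, so exactly one of them is reflected. *)
  exfalso; move: e neq_b; rewrite eX eX'.
  by case: b b' => -[] // /pt_inj [e1 e2] _; rewrite e1 e2 in specX;
    exact: (vpath_spec_not_swap s1 t1 specX specX').
Qed.
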